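(* Let $n \geq 1$, $m \geq 2$, $p \geq 2$ be integers. Let $Y \subseteq \mathbb{C}^n$ be the set of all points $(a_1,\ldots,a_n)$ such that the numbers $a_1^m,\ldots,a_n^m$ take at most $p$ distinct values. Then the ideal of all polynomials in $\mathbb{C}[x_1,\ldots,x_n]$ vanishing on $Y$ equals \[\Big\langle \prod_{i \equiv_{\lambda} j,\ i<j} (x_i^m - x_j^m) \;\Big|\; \lambda \text{ a set partition of } [n] \text{ having a unique non-singleton block, of size } p+1\Big\rangle.\]
   Context: $[n]=\{1,\ldots,n\}$. For a set partition $\lambda$ of $[n]$ into disjoint nonempty blocks, $i \equiv_\lambda j$ means that $i$ and $j$ lie in the same block of $\lambda$; the product runs over all pairs $i<j$ in a common block. The partitions considered consist of one block of size $p+1$ with all other blocks singletons. *)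

(* Defs.v *)
From mathcomp Require Import all_boot all_order all_algebra.
From mathcomp Require Export mpoly complex reals.

Set Implicit Arguments.
Unset Strict Implicit.
Unset Printing Implicit Defensive.

Import GRing.Theory.

Local Open Scope ring_scope.

Definition in_ideal_gen (R : comNzRingType) (S : R -> Prop) (f : R) : Prop :=
  exists (k : nat) (c g : 'I_k -> R),
    (forall i, S (g i)) /\ f = \sum_(i < k) c i * g i.

Definition vanishing_ideal (K : comNzRingType) (n : nat)
    (Y : ('I_n -> K) -> Prop) (f : {mpoly K[n]}) : Prop :=
  forall a : 'I_n -> K, Y a -> f.@[a] = 0.

Definition few_powers (K : comNzRingType) (n m p : nat)
    (a : 'I_n -> K) : Prop :=
  (size (undup [seq a i ^+ m | i : 'I_n]) <= p)%N.

Definition unique_nonsingleton_block (n k : nat)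
    (lambda : {set {set 'I_n}}) : Prop :=
  partition lambda [set: 'I_n] /\
  exists2 B : {set 'I_n}, #|B| = k
    & [set A in lambda | #|A| != 1%N] = [set B].

Definition same_block (n : nat) (lambda : {set {set 'I_n}}) : rel 'I_n :=
  fun i j => [exists B in lambda, (i \in B) && (j \in B)].

Definition block_prod (K : comNzRingType) (n m : nat)
    (lambda : {set {set 'I_n}}) : {mpoly K[n]} :=
  \prod_(i < n) \prod_(j < n | (i < j)%N && same_block lambda i j)
    ('X_i ^+ m - 'X_j ^+ m).

(* Main.v *)
(** The products are a Groebner basis.  For the degree-lexicographic order, the
    product of the [x_i ^ m - x_j ^ m] over the pairs in [B] has leading
    monomial [\prod_(i in B) x_i ^ (m #{j in B | j > i})], so every polynomial
    is congruent, modulo the ideal of the products, to an [r] none of whose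
    monomials is divisible by such a leading monomial.  It remains to see that
    [r = 0] if [r] vanishes on [Y].  Choose the values of the variables one
    after the other, starting from the last one, and let [b] be the set of their
    [m]-th powers.  In the next variable [t], the slices of [r] whose monomials
    would allow [b] to grow too much have degree less than [m #|b|]; they vanish
    at the [m #|b|] points with [t ^ m] in [b] (if [0] is not in [b]), hence are
    zero.  So [t ^ m] may be added to [b], and the argument continues with fewer
    variables; the excluded value [t = 0] does not matter, a slice being a
    polynomial in [t]. *)

Require Import Defs.
From mathcomp Require Import all_boot all_order all_algebra.
From mathcomp Require Import separable boolp.
From mathcomp Require Import mpoly complex reals.

Set Implicit Arguments.
Unset Strict Implicit.
Unset Printing Implicit Defensive.

Import Order.TTheory GRing.Theory Num.Theory.

Local Open Scope ring_scope.

Local Notation widen := (widen_ord (leqnSn _)).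

Section GeneratedIdeal.
Variables (A : comNzRingType) (S : A -> Prop).

Lemma in_ideal_gen0 : in_ideal_gen S 0.
Proof.
exists 0%N, (fun=> 0), (fun=> 0); split; first by case.
by rewrite big_ord0.
Qed.

Lemma in_ideal_genD f g :
  in_ideal_gen S f -> in_ideal_gen S g -> in_ideal_gen S (f + g).
Proof.
move=> [k [c [u [Su ->]]]] [l [d [v [Sv ->]]]].
exists (k + l)%N, (fun i => match split i with inl j => c j | inr j => d j end),
  (fun i => match split i with inl j => u j | inr j => v j end).
split=> [i|]; first by case: (split i).
rewrite big_split_ord /=; congr (_ + _); apply: eq_bigr => i _.
  by rewrite -[lshift l i]/(unsplit (inl i)) unsplitK.
by rewrite -[rshift k i]/(unsplit (inr i)) unsplitK.
Qed.

Lemma in_ideal_genMl c g : S g -> in_ideal_gen S (c * g).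
Proof. by exists 1%N, (fun=> c), (fun=> g); rewrite big_ord1. Qed.

Lemma in_ideal_gen_iff (S' : A -> Prop) f :
  (forall g, S g <-> S' g) -> in_ideal_gen S f <-> in_ideal_gen S' f.
Proof.
by move=> eqS; split=> -[k [c [u [Su ->]]]]; exists k, c, u; split=> // i;
  apply/eqS.
Qed.

End GeneratedIdeal.

Section VanishingIdeal.
Variables (K : comNzRingType) (n : nat) (Y : ('I_n -> K) -> Prop).

Lemma in_ideal_gen_vanishing (S : {mpoly K[n]} -> Prop) f :
  (forall g, S g -> vanishing_ideal Y g) -> in_ideal_gen S f ->
  vanishing_ideal Y f.
Proof.
move=> S0 [k [c [u [Su ->]]]] a Ya; rewrite rmorph_sum big1 //= => i _.
by rewrite rmorphM /= (S0 _ (Su i)) ?mulr0.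
Qed.

Lemma vanishing_ideal_eqmod f g :
  vanishing_ideal Y (f - g) -> vanishing_ideal Y f -> vanishing_ideal Y g.
Proof. by move=> fg0 f0 a Ya; rewrite -[g](subKr f) mevalB fg0 ?f0 ?subr0. Qed.

End VanishingIdeal.

Lemma mleadB_lt (R : nzRingType) (n : nat) (f g : {mpoly R[n]}) :
  mlead g = mlead f -> mleadc g = mleadc f -> f != g ->
  (mlead (f - g) < mlead f)%O.
Proof.
move=> eql eqc neqfg; rewrite lt_neqAle; apply/andP; split.
  apply: contra neqfg => /eqP eqfg; rewrite -subr_eq0 -mleadc_eq0 eqfg.
  by rewrite mcoeffB -eqc eql subrr.
by apply: le_trans (mleadB_le _ _) _; rewrite eql joinxx.
Qed.

Section Division.
Variables (K : fieldType) (n : nat).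
Implicit Types (f g r : {mpoly K[n]}).

Lemma exists_multiple_same_lead f g :
  f != 0 -> g != 0 -> (mlead g <= mlead f)%MM ->
  exists h, mlead (h * g) = mlead f /\ mleadc (h * g) = mleadc f.
Proof.
move=> f_neq0 g_neq0 le_gf.
have c_neq0 : mleadc f / mleadc g != 0.
  by rewrite mulf_neq0 ?invr_eq0 ?mleadc_eq0.
pose h : {mpoly K[n]} := (mleadc f / mleadc g) *: 'X_[mlead f - mlead g].
have lead_h : mlead h = (mlead f - mlead g)%MM by rewrite mleadZ // mleadXm.
have leadc_h : mleadc h = mleadc f / mleadc g.
  by rewrite lead_h mcoeffZ mcoeffX eqxx mulr1.
have lead_hg : mlead (h * g) = (mlead h + mlead g)%MM.
  by rewrite mleadM // -mleadc_eq0 leadc_h.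
exists h; split; first by rewrite lead_hg lead_h submK.
by rewrite lead_hg mleadcM leadc_h divfK ?mleadc_eq0.
Qed.

Variable S : {mpoly K[n]} -> Prop.

Definition reduced r : Prop :=
  forall M g, M \in msupp r -> S g -> g != 0 -> ~~ (mlead g <= M)%MM.

Lemma reduced0 : reduced 0.
Proof. by move=> M g; rewrite msupp0. Qed.

Lemma reducedDX r c M :
  reduced r -> (forall g, S g -> g != 0 -> ~~ (mlead g <= M)%MM) ->
  reduced (r + c *: 'X_[M]).
Proof.
move=> red_r red_M M' g /msuppD_le; rewrite mem_cat => /orP[/red_r|/msuppZ_le].
  exact.
by rewrite msuppX inE => /eqP->; apply: red_M.
Qed.

Lemma exists_reduced_remainder f :
  exists2 r, in_ideal_gen S (f - r) & reduced r.
Proof.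
elim/mleadrect: f => f IHf.
have [->|f_neq0] := eqVneq f 0.
  by exists 0; [rewrite subr0; apply: in_ideal_gen0 | apply: reduced0].
have IHlead g : mlead g = mlead f -> mleadc g = mleadc f ->
    exists2 r, in_ideal_gen S (f - g - r) & reduced r.
  move=> eql eqc; have [<-|nefg] := eqVneq f g; last exact/IHf/mleadB_lt.
  by exists 0; [rewrite subrr subr0; apply: in_ideal_gen0 | apply: reduced0].
have [[g [Sg g_neq0 le_gf]]|irr] :=
    EM (exists g, [/\ S g, g != 0 & (mlead g <= mlead f)%MM]).
  have [h [lead_hg leadc_hg]] := exists_multiple_same_lead f_neq0 g_neq0 le_gf.
  have [r Sr red_r] := IHlead _ lead_hg leadc_hg.
  exists r => //; rewrite -(subrK (h * g) f) addrAC.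
  exact: in_ideal_genD Sr (in_ideal_genMl h Sg).
have [||r Sr red_r] := IHlead (mleadc f *: 'X_[mlead f]).
- by rewrite mleadZ ?mleadXm // mleadc_eq0.
- by rewrite mleadcZE mleadXm mcoeffX eqxx mulr1.
exists (r + mleadc f *: 'X_[mlead f]); first by rewrite opprD addrA addrAC.
apply: reducedDX => // g Sg g_neq0; apply/negP => le_gf.
by apply: irr; exists g.
Qed.

End Division.

Lemma natr_neq0_gt0 (R : nzRingType) (m : nat) : m%:R != 0 :> R -> (0 < m)%N.
Proof. by case: m => //; rewrite eqxx. Qed.

Lemma separable_XnsubC (F : fieldType) (m : nat) (c : F) :
  m%:R != 0 :> F -> c != 0 -> separable_poly ('X^m - c%:P).
Proof.
case: m => [/eqP//|m] m_neq0 c_neq0; rewrite unlock derivB derivC subr0.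
rewrite derivXn -scaler_nat coprimepZr // coprimep_expr // coprimepX.
by rewrite rootE !hornerE expr0n sub0r oppr_eq0.
Qed.

Section PowerRoots.
Variable K : closedFieldType.

Lemma separable_uniq_roots (P : {poly K}) :
  separable_poly P ->
  exists r : seq K, [/\ size r = (size P).-1, uniq r & all (root P) r].
Proof.
move=> sepP; have [r defP] := closed_field_poly_normal P.
have c_neq0 : lead_coef P != 0 by rewrite lead_coef_eq0 separable_poly_neq0.
exists r; split.
- by rewrite defP size_scale // size_prod_XsubC.
- by rewrite -separable_prod_XsubC -(eqp_separable (eqp_scale _ c_neq0)) -defP.
- by apply/allP=> x xr; rewrite defP rootZ // root_prod_XsubC.
Qed.

Lemma exists_uniq_roots_Xn (m : nat) (b : seq K) :
  m%:R != 0 :> K -> uniq b -> 0 \notin b ->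
  exists r : seq K,
    [/\ size r = (m * size b)%N, uniq r & forall x, x \in r -> x ^+ m \in b].
Proof.
move=> m_neq0; elim: b => [|y b IHb] /=; first by exists [::]; rewrite muln0.
case/andP=> yNb b_uniq; rewrite inE eq_sym negb_or => /andP[y_neq0 b0].
have [r [size_r r_uniq rb]] := IHb b_uniq b0.
have m_gt0 := natr_neq0_gt0 m_neq0.
have [u []] := separable_uniq_roots (separable_XnsubC m_neq0 y_neq0).
rewrite size_XnsubC //= => size_u u_uniq /allP u_root.
have uy x : x \in u -> x ^+ m = y.
  by move/u_root; rewrite rootE !hornerE subr_eq0 => /eqP.
exists (u ++ r); split=> [||x].
- by rewrite size_cat size_u size_r mulnS.
- rewrite cat_uniq u_uniq r_uniq andbT /=; apply/hasPn => x xr.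
  by apply: contra yNb => xu; rewrite -(uy _ xu) rb.
- rewrite mem_cat inE => /orP[/uy->|/rb->]; first by rewrite eqxx.
  by rewrite orbT.
Qed.

Lemma poly_eq0_on_nonzero (P : {poly K}) :
  (forall t, t != 0 -> P.[t] = 0) -> P = 0.
Proof.
move=> P0.
(* Two consecutive integers do not both vanish in [K]. *)
have [d [le_d d_neq0]] : exists d, (size P <= d)%N /\ d%:R != 0 :> K.
  have [d0|d_neq0] := eqVneq ((size P)%:R : K) 0; last by exists (size P).
  by exists (size P).+1; rewrite leqnSn -natr1 d0 add0r oner_neq0.
have [||r [size_r r_uniq r1]] := @exists_uniq_roots_Xn d [:: 1] d_neq0 => //.
  by rewrite inE eq_sym oner_neq0.
apply: (roots_geq_poly_eq0 _ r_uniq); last by rewrite size_r muln1.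
apply/allP => t /r1; rewrite inE rootE => /eqP td; rewrite P0 //.
apply: contraNneq d_neq0 => t0; move/eqP: td.
rewrite t0 expr0n; case: d {le_d size_r r1} => //= d.
by rewrite eq_sym oner_eq0.
Qed.

End PowerRoots.

Section AppendLast.
Variables (T : Type) (n : nat).

Definition rcons_fun (a : 'I_n -> T) (t : T) (i : 'I_n.+1) : T :=
  oapp a t (unlift ord_max i).

Lemma rcons_fun_max a t : rcons_fun a t ord_max = t.
Proof. by rewrite /rcons_fun unlift_none. Qed.

Lemma rcons_fun_widen a t (i : 'I_n) : rcons_fun a t (widen i) = a i.
Proof.
rewrite /rcons_fun (_ : widen i = lift ord_max i) ?liftK //.
exact/val_inj/esym/lift_max.
Qed.

Lemma ord_rcons_ind (P : 'I_n.+1 -> Prop) :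
  (forall i : 'I_n, P (widen i)) -> P ord_max -> forall i, P i.
Proof.
move=> Pw Pmax i; case: (unliftP ord_max i) => [j|] -> //.
by rewrite (_ : lift _ _ = widen j) //; apply/val_inj/lift_max.
Qed.

End AppendLast.

Section AppendExponent.
Variable n : nat.
Implicit Types (e : 'X_{1..n}) (M : 'X_{1..n.+1}).

Definition mnm_rcons e (k : nat) : 'X_{1..n.+1} :=
  [multinom rcons_fun e k i | i < n.+1].

Definition mnm_init M : 'X_{1..n} := [multinom M (widen i) | i < n].

Lemma mnm_rcons_max e k : mnm_rcons e k ord_max = k.
Proof. by rewrite mnmE rcons_fun_max. Qed.

Lemma mnm_rcons_widen e k (i : 'I_n) : mnm_rcons e k (widen i) = e i.
Proof. by rewrite mnmE rcons_fun_widen. Qed.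

Lemma eq_mnm_rcons M e k :
  (M == mnm_rcons e k) = (mnm_init M == e) && (M ord_max == k).
Proof.
apply/eqP/andP=> [->|[/eqP<- /eqP<-]].
  rewrite mnm_rcons_max eqxx; split=> //; apply/eqP/mnmP => i.
  by rewrite mnmE mnm_rcons_widen.
apply/mnmP; apply: ord_rcons_ind => [i|]; last by rewrite mnm_rcons_max.
by rewrite mnm_rcons_widen mnmE.
Qed.

Lemma lepm_rcons e e' k k' :
  (e <= e')%MM -> (k <= k')%N -> (mnm_rcons e k <= mnm_rcons e' k')%MM.
Proof.
move=> /mnm_lepP le_e le_k; apply/mnm_lepP; apply: ord_rcons_ind => [i|].
  by rewrite !mnm_rcons_widen.
by rewrite !mnm_rcons_max.
Qed.

End AppendExponent.

Section LastVariable.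
Variables (K : comNzRingType) (n : nat).
Implicit Types (f : {mpoly K[n.+1]}) (e : 'X_{1..n}).

Definition last_eval f (t : K) : {mpoly K[n]} := (muni f).[t%:MP].

Definition slice f e : {poly K} := map_poly (mcoeff e) (muni f).

Lemma coef_slice f e k : (slice f e)`_k = f@_(mnm_rcons e k).
Proof.
rewrite coef_map /= muniE coef_sum raddf_sum /= [in RHS](mpolyE f) raddf_sum /=.
apply: eq_bigr => M _; rewrite -mul_mpolyC.
rewrite coefZ coefXn -/(mnm_init M) mcoeffZ mcoeffX eq_mnm_rcons.
rewrite mulr_natr mcoeffMn mcoeffCM mcoeffX [k == _]eq_sym.
by rewrite -mulnb natrM mulrA [RHS]mulr_natr.
Qed.

Lemma mcoeff_last_eval f t e : (last_eval f t)@_e = (slice f e).[t].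
Proof.
rewrite /last_eval /slice (horner_coef_wide _ (size_poly _ _)) horner_coef.
rewrite raddf_sum /=; apply: eq_bigr => i _.
by rewrite coef_map /= -rmorphXn /= mulrC mcoeffCM mulrC.
Qed.

Lemma meval_last_eval f t a : (last_eval f t).@[a] = f.@[rcons_fun a t].
Proof.
rewrite /last_eval muniE horner_sum rmorph_sum mevalE; apply: eq_bigr => M _.
rewrite hornerZ hornerXn -rmorphXn /= mevalM mevalC mevalZ mevalX.
rewrite big_ord_recr /= rcons_fun_max mulrA; congr (_ * _ * _).
by apply: eq_bigr => i _; rewrite mnmE rcons_fun_widen.
Qed.

Lemma slice_eq0 f : (forall e, slice f e = 0) -> f = 0.
Proof.
move=> f0; apply/mpolyP => M; rewrite mcoeff0.
have /eqP-> : M == mnm_rcons (mnm_init M) (M ord_max).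
  by rewrite eq_mnm_rcons !eqxx.
by rewrite -coef_slice f0 coef0.
Qed.

Lemma msupp_last_eval f t e :
  e \in msupp (last_eval f t) -> exists k, mnm_rcons e k \in msupp f.
Proof.
rewrite mcoeff_msupp mcoeff_last_eval => slice_neq0.
exists (size (slice f e)).-1; rewrite mcoeff_msupp -coef_slice -lead_coefE.
by rewrite lead_coef_eq0; apply: contraNneq slice_neq0 => ->; rewrite horner0.
Qed.

End LastVariable.

Section Staircase.
Variables (n m : nat).
Implicit Types (c q : nat) (S : {set 'I_n}) (e : 'X_{1..n}).

Definition above S (i : 'I_n) : {set 'I_n} := [set j in S | (i < j)%N].

(* For [c = 0], the leading monomial of the product of the [x_i ^ m - x_j ^ m]
   over the pairs in [S]; [c] counts further indices above all those of [S]. *)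
Definition staircase c S : 'X_{1..n} :=
  [multinom if i \in S then (m * (c + #|above S i|))%N else 0%N | i < n].

Definition above_staircase c q e : Prop :=
  exists2 S : {set 'I_n}, #|S| = q & (staircase c S <= e)%MM.

Lemma above_staircase0 c e : above_staircase c 0 e.
Proof.
exists set0; first by rewrite cards0.
by apply/mnm_lepP => i; rewrite mnmE inE.
Qed.

End Staircase.

Section StaircaseRcons.
Variables (n m : nat).
Implicit Types (c q k : nat) (S : {set 'I_n}) (e : 'X_{1..n}).

Let widen_inj : injective (widen : 'I_n -> 'I_n.+1).
Proof. by move=> i j /(congr1 val) /= /val_inj. Qed.

Lemma max_notin_widen S : ord_max \notin [set widen i | i in S].
Proof.
apply/imsetP => -[i _ /(congr1 val)/= eqi].
by have := ltn_ord i; rewrite -eqi ltnn.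
Qed.

Lemma above_widen S i :
  above [set widen j | j in S] (widen i) = [set widen j | j in above S i].
Proof.
apply/setP; apply: ord_rcons_ind => [j|].
  by rewrite inE !(mem_imset _ _ widen_inj) inE.
by rewrite inE !(negPf (max_notin_widen _)).
Qed.

Lemma above_widenU_max S i :
  above (ord_max |: [set widen j | j in S]) (widen i) =
  ord_max |: [set widen j | j in above S i].
Proof.
rewrite -above_widen; apply/setP => j; rewrite !inE andb_orl.
by case: eqP => //= ->; rewrite ltn_ord.
Qed.

Lemma above_max (S : {set 'I_n.+1}) : above S ord_max = set0.
Proof. by apply/setP => j; rewrite !inE ltnNge -ltnS ltn_ord andbF. Qed.

Lemma staircase_widen c S :
  staircase m c [set widen i | i in S] = mnm_rcons (staircase m c S) 0.
Proof.
apply/mnmP; apply: ord_rcons_ind => [i|].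
  rewrite mnm_rcons_widen !mnmE (mem_imset _ _ widen_inj) above_widen.
  by rewrite card_imset.
by rewrite mnm_rcons_max mnmE (negPf (max_notin_widen _)).
Qed.

Lemma staircase_widenU_max c S :
  staircase m c (ord_max |: [set widen i | i in S]) =
  mnm_rcons (staircase m c.+1 S) (m * c).
Proof.
apply/mnmP; apply: ord_rcons_ind => [i|]; last first.
  by rewrite mnm_rcons_max mnmE setU11 above_max cards0 addn0.
rewrite mnm_rcons_widen !mnmE above_widenU_max cardsU1 max_notin_widen.
rewrite card_imset // addSnnS in_setU1 (mem_imset _ _ widen_inj).
by rewrite -val_eqE /= ltn_eqF.
Qed.

Lemma above_staircase_rcons c q e k :
  above_staircase m c q e -> above_staircase m c q (mnm_rcons e k).
Proof.
case=> S cardS le_e; exists [set widen i | i in S]; first by rewrite card_imset.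
by rewrite staircase_widen lepm_rcons.
Qed.

Lemma above_staircase_rconsS c q e k :
  (m * c <= k)%N ->
  above_staircase m c.+1 q e -> above_staircase m c q.+1 (mnm_rcons e k).
Proof.
move=> le_k [S cardS le_e]; exists (ord_max |: [set widen i | i in S]).
  by rewrite cardsU1 max_notin_widen card_imset // cardS.
by rewrite staircase_widenU_max lepm_rcons.
Qed.

End StaircaseRcons.

Definition staircase_free (K : nzRingType) (n m c q : nat)
    (f : {mpoly K[n]}) : Prop :=
  forall e, e \in msupp f -> ~ above_staircase m c q e.

Lemma staircase_free0 (K : nzRingType) (n m c : nat) (f : {mpoly K[n]}) :
  staircase_free m c 0 f -> f = 0.
Proof.
move=> free_f; apply/mpolyP => e; rewrite mcoeff0 memN_msupp_eq0 //.
by apply/negP => /free_f; apply; apply: above_staircase0.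
Qed.

Section StaircaseFreeSlices.
Variables (K : comNzRingType) (n m c q : nat) (f : {mpoly K[n.+1]}).

Lemma staircase_free_last_eval t :
  staircase_free m c q f -> staircase_free m c q (last_eval f t).
Proof.
move=> free_f e /msupp_last_eval[k /free_f ek] st_e.
exact/ek/above_staircase_rcons.
Qed.

Lemma size_slice_staircase_free e :
  staircase_free m c q.+1 f -> above_staircase m c.+1 q e ->
  (size (slice f e) <= m * c)%N.
Proof.
move=> free_f st_e; apply/leq_sizeP => k le_k.
rewrite coef_slice memN_msupp_eq0 //; apply/negP => /free_f; apply.
exact: above_staircase_rconsS.
Qed.

End StaircaseFreeSlices.

Section FewPowers.
Variables (K : comNzRingType) (m : nat).

(* The bound is strict, so that [q] is also the size of the staircases that the
   polynomials vanishing at such points have to avoid. *)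
Definition few_powers_over (n q : nat) (b : seq K) (a : 'I_n -> K) : Prop :=
  exists s : seq K, [/\ (size s < q + size b)%N, {subset b <= s}
    & forall i, a i ^+ m \in s].

Lemma few_powersP (n p : nat) (a : 'I_n -> K) :
  few_powers m p a <-> few_powers_over p.+1 [::] a.
Proof.
split=> [few_a|[s [size_s _ sa]]].
  exists (undup [seq a i ^+ m | i : 'I_n]); split=> // [|i].
    by rewrite addn0 ltnS.
  by rewrite mem_undup; apply/mapP; exists i; rewrite // mem_enum.
rewrite addn0 ltnS in size_s.
apply: leq_trans size_s; apply: uniq_leq_size (undup_uniq _) _ => x.
by rewrite mem_undup => /mapP[i _ ->].
Qed.

Lemma few_powers_over_rcons (n q : nat) (b : seq K) (a : 'I_n -> K) t :
  t ^+ m \in b -> few_powers_over q b a -> few_powers_over q b (rcons_fun a t).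
Proof.
move=> bt [s [size_s bs sa]]; exists s; split=> //.
apply: ord_rcons_ind => [i|]; first by rewrite rcons_fun_widen.
by rewrite rcons_fun_max bs.
Qed.

Lemma few_powers_over_rconsS (n q : nat) (b : seq K) (a : 'I_n -> K) t :
  few_powers_over q (t ^+ m :: b) a -> few_powers_over q.+1 b (rcons_fun a t).
Proof.
move=> [s [size_s bs sa]]; exists s; split=> [|x xb|].
- by rewrite addSnnS.
- by rewrite bs // inE xb orbT.
apply: ord_rcons_ind => [i|]; first by rewrite rcons_fun_widen.
by rewrite rcons_fun_max bs ?mem_head.
Qed.

End FewPowers.

Section StaircaseFreeVanishing.
Variables (K : closedFieldType) (m : nat).
Hypothesis m_neq0 : m%:R != 0 :> K.

Lemma slice_staircase_eq0 (n q : nat) (b : seq K) (f : {mpoly K[n.+1]}) e :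
  uniq b -> 0 \notin b -> staircase_free m (size b) q.+1 f ->
  (forall t, t ^+ m \in b -> last_eval f t = 0) ->
  above_staircase m (size b).+1 q e -> slice f e = 0.
Proof.
move=> b_uniq b0 free_f f0 st_e.
have [r [size_r r_uniq rb]] := exists_uniq_roots_Xn m_neq0 b_uniq b0.
apply: (roots_geq_poly_eq0 _ r_uniq).
  by apply/allP => t /rb bt; rewrite rootE -mcoeff_last_eval f0 ?mcoeff0.
by rewrite size_r (size_slice_staircase_free free_f).
Qed.

Lemma staircase_free_vanishing_eq0 (n q : nat) (b : seq K) (f : {mpoly K[n]}) :
  uniq b -> 0 \notin b -> staircase_free m (size b) q f ->
  vanishing_ideal (@few_powers_over K m n q b) f -> f = 0.
Proof.
elim: n q b f => [|n IHn] [|q] b f b_uniq b0 free_f van_f.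
- exact: staircase_free0 free_f.
- have : f.@[fun=> 0] = 0.
    by apply: van_f; exists b; split=> // [|[]//]; rewrite addSn ltnS leq_addl.
  by rewrite [f]nvar0_mpolyC mevalC => ->; rewrite mpolyC0.
- exact: staircase_free0 free_f.
have eval_old t : t ^+ m \in b -> last_eval f t = 0.
  move=> bt; apply: (IHn q.+1 b) => //; first exact: staircase_free_last_eval.
  move=> a few_a; rewrite meval_last_eval van_f //.
  exact: few_powers_over_rcons.
have eval_new t : t != 0 -> last_eval f t = 0.
  move=> t_neq0; have [/eval_old //|tNb] := boolP (t ^+ m \in b).
  apply: (IHn q (t ^+ m :: b)) => /= [|| e|a few_a].
  - by rewrite tNb.
  - by rewrite inE eq_sym expf_eq0 negb_or negb_and t_neq0 orbT.
  - rewrite mcoeff_msupp mcoeff_last_eval => /eqP slice_neq0 st_e.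
    by apply: slice_neq0; rewrite (slice_staircase_eq0 _ _ free_f) ?horner0.
  - by rewrite meval_last_eval van_f //; apply: few_powers_over_rconsS.
apply: slice_eq0 => e; apply: poly_eq0_on_nonzero => t /eval_new ft0.
by rewrite -mcoeff_last_eval ft0 mcoeff0.
Qed.

End StaircaseFreeVanishing.

Definition vandermonde_prod (K : comNzRingType) (n m : nat) (B : {set 'I_n}) :
    {mpoly K[n]} :=
  \prod_(i < n) \prod_(j < n | (i < j)%N && ((i \in B) && (j \in B)))
    ('X_i ^+ m - 'X_j ^+ m).

Section VandermondeLead.
Variables (K : idomainType) (n m : nat).
Hypothesis m_gt0 : (0 < m)%N.

Lemma mlead_XnB (i j : 'I_n) : (i < j)%N ->
  mlead ('X_i ^+ m - 'X_j ^+ m : {mpoly K[n]}) = (U_(i) *+ m)%MM.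
Proof.
move=> ltij; rewrite !mpolyXn mleadDl mleadXm // mleadN mleadXm.
apply/ltmcP; first by rewrite !mdegMn !mdeg1.
exists i => [k ltki|]; rewrite !mulmnE !mnm1E.
  by rewrite -!val_eqE /= gtn_eqF ?(ltn_trans ltki) // gtn_eqF.
by rewrite eqxx -val_eqE /= gtn_eqF // mul1n.
Qed.

Lemma XnB_neq0 (i j : 'I_n) : (i < j)%N ->
  'X_i ^+ m - 'X_j ^+ m != 0 :> {mpoly K[n]}.
Proof.
move=> ltij; apply/eqP => /(congr1 (@mlead _ _)).
rewrite mlead_XnB // mlead0 => /mnmP/(_ i).
by rewrite mulmnE mnm1E eqxx mul1n mnm0E => m0; move: m_gt0; rewrite m0.
Qed.

Lemma vandermonde_prod_neq0 B : vandermonde_prod K m B != 0 :> {mpoly K[n]}.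
Proof.
apply/prodf_neq0 => i _; apply/prodf_neq0 => j /andP[ltij _].
exact: XnB_neq0.
Qed.

Lemma mlead_vandermonde_prod (B : {set 'I_n}) :
  mlead (vandermonde_prod K m B) = staircase m 0 B.
Proof.
rewrite /vandermonde_prod mlead_prod => [|i _ _]; last first.
  by apply/prodf_neq0 => j /andP[ltij _]; apply: XnB_neq0.
transitivity (\sum_(i < n) U_(i) *+ staircase m 0 B i)%MM; last first.
  by rewrite -multinomUE_id.
apply: eq_bigr => i _; rewrite mlead_prod => [|j _ /andP[ltij _]]; last first.
  exact: XnB_neq0.
apply/mnmP => k; rewrite mnm_sumE mulmnE mnm1E.
rewrite (eq_bigr (fun=> (i == k) * m)%N) => [|j /andP[ltij _]]; last first.
  by rewrite mlead_XnB // mulmnE mnm1E.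
rewrite sum_nat_const mulnCA mnmE add0n; congr (_ * _)%N.
case: (boolP (i \in B)) => iB; last first.
  by rewrite eq_card0 // => j; rewrite unfold_in /= andbF.
by rewrite mulnC; congr (_ * _)%N; apply: eq_card => j; rewrite !inE /= andbC.
Qed.

End VandermondeLead.

Section VandermondeVanishing.
Variables (K : idomainType) (n m : nat).

Lemma meval_vandermonde_prod_eq0 (B : {set 'I_n}) (a : 'I_n -> K) i j :
  i \in B -> j \in B -> i != j -> a i ^+ m = a j ^+ m ->
  (vandermonde_prod K m B).@[a] = 0.
Proof.
wlog ltij : i j / (i < j)%N.
  move=> wlog_lt iB jB neij eqa; move: (neij).
  rewrite neq_ltn => /orP[/wlog_lt|/wlog_lt]; first exact.
  by apply; rewrite // eq_sym.
move=> iB jB _ eqa; rewrite /vandermonde_prod rmorph_prod (bigD1 i) //=.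
rewrite rmorph_prod (bigD1 j) /=; last by rewrite ltij iB.
by rewrite rmorphB !rmorphXn /= !mevalXU eqa subrr !mul0r.
Qed.

Lemma vandermonde_prod_vanishing p (B : {set 'I_n}) :
  (p < #|B|)%N ->
  vanishing_ideal (@few_powers K n m p) (vandermonde_prod K m B).
Proof.
move=> lt_pB a few_a.
have /dinjectivePn[i iB [j]] : ~~ dinjectiveb (fun i => a i ^+ m) B.
  apply: contraL lt_pB => inj; rewrite -leqNgt; apply: leq_trans few_a.
  rewrite cardE -(size_map (fun i => a i ^+ m)); apply: (uniq_leq_size inj).
  by move=> _ /mapP[i _ ->]; rewrite mem_undup; apply: map_f; rewrite mem_enum.
rewrite !inE => /andP[neji jB].
by apply: meval_vandermonde_prod_eq0; rewrite // eq_sym.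
Qed.

End VandermondeVanishing.

Section Blocks.
Variable n : nat.
Implicit Types (lambda : {set {set 'I_n}}) (B : {set 'I_n}).

Lemma same_blockE lambda B (i j : 'I_n) :
  [set A in lambda | #|A| != 1%N] = [set B] -> i != j ->
  same_block lambda i j = (i \in B) && (j \in B).
Proof.
move=> lamB neij; apply/exists_inP/andP => [[A Al /andP[iA jA]]|[iB jB]].
  have : A \in [set A in lambda | #|A| != 1%N].
    rewrite inE Al /=; apply: contra neij => /cards1P[x defA].
    by move: iA jA; rewrite defA !inE => /eqP-> /eqP->.
  by rewrite lamB => /set1P <-.
have := set11 B; rewrite -lamB inE => /andP[Bl _].
by exists B; rewrite ?iB.
Qed.

Lemma block_prodE (K : comNzRingType) (m : nat) lambda B :
  [set A in lambda | #|A| != 1%N] = [set B] ->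
  block_prod K m lambda = vandermonde_prod K m B.
Proof.
move=> lamB; apply: eq_bigr => i _; apply: eq_bigl => j.
by apply: andb_id2l => ltij; rewrite (same_blockE lamB) // neq_ltn ltij.
Qed.

Lemma exists_partition_unique_block B :
  (1 < #|B|)%N -> exists2 lambda, partition lambda [set: 'I_n] &
    [set A in lambda | #|A| != 1%N] = [set B].
Proof.
move=> B_gt1; exists (B |: preim_partition id (~: B)).
  rewrite -(setUCr B) partitionU1 ?preim_partitionP ?disjoints_subset ?setCK //.
  by rewrite -card_gt0 ltnW.
apply/setP => A; rewrite !inE andb_orl; case: eqP => [->|_] /=.
  by rewrite gtn_eqF.
apply/negP => /andP[/imsetP[x xNB ->] /negP]; apply.
rewrite (_ : [set y in _ | _] = [set x]) ?cards1 //.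
by apply/setP => y; rewrite in_set in_set1 eq_sym andb_idl // => /eqP->.
Qed.

Lemma block_prodP (K : comNzRingType) (m k : nat) (g : {mpoly K[n]}) :
  (1 < k)%N ->
  (exists lambda,
     unique_nonsingleton_block k lambda /\ g = block_prod K m lambda)
  <-> exists2 B : {set 'I_n}, #|B| = k & g = vandermonde_prod K m B.
Proof.
move=> k_gt1; split=> [[lambda [[_ [B cardB lamB]] ->]]|[B cardB ->]].
  by exists B => //; apply: block_prodE.
have [|lambda part_lam lamB] := @exists_partition_unique_block B.
  by rewrite cardB.
exists lambda; rewrite (block_prodE _ _ lamB); split=> //.
by split=> //; exists B.
Qed.

End Blocks.

Lemma vanishing_ideal_few_powers (K : closedFieldType) (n m p : nat)
    (f : {mpoly K[n]}) :
  m%:R != 0 :> K ->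
  vanishing_ideal (@few_powers K n m p) f <->
  in_ideal_gen
    (fun g => exists2 B : {set 'I_n},
       #|B| = p.+1 & g = vandermonde_prod K m B) f.
Proof.
move=> m_neq0; set gens := fun g => _.
have m_gt0 := natr_neq0_gt0 m_neq0.
have gens_vanish g :
    in_ideal_gen gens g -> vanishing_ideal (@few_powers K n m p) g.
  apply: in_ideal_gen_vanishing => _ [B cardB ->].
  by apply: vandermonde_prod_vanishing; rewrite cardB.
split=> [f0|]; last exact: gens_vanish.
have [r fr red_r] := exists_reduced_remainder gens f.
suff r0 : r = 0 by rewrite r0 subr0 in fr.
apply: (@staircase_free_vanishing_eq0 _ _ m_neq0 n p.+1 [::])
  => // [M Mr|a few_a].
  case=> B cardB; apply/negP; rewrite -(mlead_vandermonde_prod K m_gt0).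
  by apply: red_r Mr _ _; [exists B | apply: vandermonde_prod_neq0].
by apply: vanishing_ideal_eqmod (gens_vanish _ fr) f0 _ _; apply/few_powersP.
Qed.

Theorem theorem1p4 (R : realType) (n m p : nat)
    (hn : (1 <= n)%N) (hm : (2 <= m)%N) (hp : (2 <= p)%N)
    (f : {mpoly R[i][n]}) :
  vanishing_ideal (@few_powers R[i] n m p) f <->
  in_ideal_gen
    (fun g => exists lambda : {set {set 'I_n}},
       unique_nonsingleton_block p.+1 lambda /\ g = block_prod R[i] m lambda) f.
Proof.
have m_neq0 : m%:R != 0 :> R[i] by rewrite pnatr_eq0 -lt0n ltnW.
rewrite (vanishing_ideal_few_powers p f m_neq0); apply: in_ideal_gen_iff => g.
by rewrite block_prodP // ltnS ltnW.
Qed.
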